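(* Suppose $\nu\in\mathbb C^{2n}$ is a common eigenvector of the matrices $A_k$ corresponding to the eigenvalues $\lambda^k$, $k=1,\ldots,2m$, respectively. Then the $\mathbb R$-differentiable function $$F\colon(z,w)\to(\nu\gamma)\exp\Bigl(-\sum_{j=1}^m\bigl(\lambda^jz_j+\lambda^{m+j}\overline z_j\bigr)\Bigr)\quad\text{for all }(z,w)\in\mathbb C^{m+n}$$ is a first integral of the completely solvable system $dw=X_1(w)\,dz+X_2(w)\,d\overline z$.
   Context: Let $m,n\ge 1$, $w=(w_1,\ldots,w_n)\in\mathbb C^n$, $z=(z_1,\ldots,z_m)\in\mathbb C^m$, columns. Consider $dw=X_1(w)\,dz+X_2(w)\,d\overline z$, where $X_1(w)=\|X_{\tau j}(w)\|$, $X_2(w)=\|X_{\tau,m+j}(w)\|$ ($\tau=1,\ldots,n$, $j=1,\ldots,m$) and $X_{\tau k}(w)=\sum_{\xi=1}^n\bigl(a_{\tau k\xi}w_\xi+a_{\tau k,n+\xi}\overline w_\xi\bigr)$, $k=1,\ldots,2m$, with constants $a_{\tau k\varrho}\in\mathbb C$. The associated operators are, for $j=1,\ldots,m$, $$\mathfrak x_j(w)=\sum_{\xi=1}^n\bigl(X_{\xi j}(w)\partial_{w_\xi}+\overline{X_{\xi,m+j}(w)}\,\partial_{\overline w_\xi}\bigr),\qquad \mathfrak x_{m+j}(w)=\sum_{\xi=1}^n\bigl(X_{\xi,m+j}(w)\partial_{w_\xi}+\overline{X_{\xi j}(w)}\,\partial_{\overline w_\xi}\bigr).$$ The system is assumed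 completely solvable: $[\mathfrak x_k,\mathfrak x_l]=0$ on $\mathbb C^n$ for all $k,l=1,\ldots,2m$. The $2n\times 2n$ matrices are given by columns: $A_j=\|a_{1j}\ldots a_{nj}\,\overline a_{1,m+j}\ldots\overline a_{n,m+j}\|$, $A_{m+j}=\|a_{1,m+j}\ldots a_{n,m+j}\,\overline a_{1j}\ldots\overline a_{nj}\|$, $j=1,\ldots,m$, where $a_{\tau k}$ is the column $(a_{\tau k1},\ldots,a_{\tau k,2n})$ and $\overline a_{\tau k}$ is the column $(\overline{a_{\tau k,n+1}},\ldots,\overline{a_{\tau k,2n}},\overline{a_{\tau k1}},\ldots,\overline{a_{\tau kn}})$. Complete solvability is equivalent to $A_kA_l=A_lA_k$ for all $k,l$. Put $\gamma=(w_1,\ldots,w_n,\overline w_1,\ldots,\overline w_n)$ and $\nu\gamma=\sum_{\varrho=1}^{2n}\nu_\varrho\gamma_\varrho$. $\mathbb R$-differentiable means continuously differentiable in the real and imaginary parts of the variables. Put $\mathfrak X_j(z,w)=\partial_{z_j}+\mathfrak x_j(w)$, $\mathfrak X_{m+j}(z,w)=\partial_{\overline z_j}+\mathfrak x_{m+j}(w)$, $j=1,\ldots,m$. An $\mathbb R$-differentiable function $F(z,w)$ is a first integral of the system on a domain if $\mathfrak X_kF=0$ there for $k=1,\ldots,2m$. *)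

(* Defs.v *)
From HB Require Import structures.
From mathcomp Require Import all_boot all_order all_algebra.
From mathcomp Require Import complex.
From mathcomp Require Import all_classical all_reals all_analysis.

Set Implicit Arguments.
Unset Strict Implicit.
Unset Printing Implicit Defensive.

Import Order.TTheory GRing.Theory Num.Theory.
Import numFieldNormedType.Exports.
Local Open Scope classical_set_scope.
Local Open Scope ring_scope.
Local Open Scope complex_scope.

Definition cexp (R : realType) (x : R[i]) : R[i] :=
  (expR (complex.Re x))%:C * (cos (complex.Im x) +i* sin (complex.Im x)).

(* C^N is identified with R^(N + N): first the N real parts, then the N
   imaginary parts. *)
Definition coords (R : realType) (N : nat) (p : 'cV[R[i]]_N) : 'cV[R]_(N + N) :=
  col_mx (map_mx (@complex.Re R) p) (map_mx (@complex.Im R) p).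

Definition of_coords (R : realType) (N : nat) (q : 'cV[R]_(N + N)) :
    'cV[R[i]]_N :=
  \col_i (q (lshift N i) ord0 +i* q (rshift N i) ord0).

Definition re_part (R : realType) (N : nat) (f : 'cV[R[i]]_N -> R[i]) :
    'cV[R]_(N + N) -> R :=
  fun q => complex.Re (f (of_coords q)).

Definition im_part (R : realType) (N : nat) (f : 'cV[R[i]]_N -> R[i]) :
    'cV[R]_(N + N) -> R :=
  fun q => complex.Im (f (of_coords q)).

(* Partial derivative of a complex-valued function with respect to the s-th
   real coordinate: the real part of the variable number i for
   s = lshift N i, its imaginary part for s = rshift N i. *)
Definition pderiv (R : realType) (N : nat) (s : 'I_(N + N))
    (f : 'cV[R[i]]_N -> R[i]) : 'cV[R[i]]_N -> R[i] :=
  fun p => 'D_(delta_mx s ord0) (re_part f) (coords p)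
        +i* 'D_(delta_mx s ord0) (im_part f) (coords p).

(* R-differentiability: f has continuous first partial derivatives in the real
   and imaginary parts of its variables at the points of D, which is meant to
   be open. *)
Definition R_differentiable (R : realType) (N : nat) (D : set 'cV[R[i]]_N)
    (f : 'cV[R[i]]_N -> R[i]) : Prop :=
  forall p, D p -> forall s : 'I_(N + N),
    [/\ derivable (re_part f) (coords p) (delta_mx s ord0),
        derivable (im_part f) (coords p) (delta_mx s ord0),
        {for coords p, continuous
          (fun q : 'cV[R]_(N + N) => 'D_(delta_mx s ord0) (re_part f) q)} &
        {for coords p, continuous
          (fun q : 'cV[R]_(N + N) => 'D_(delta_mx s ord0) (im_part f) q)}].

Definition R_differentiable2 (R : realType) (N : nat) (D : set 'cV[R[i]]_N)
    (f : 'cV[R[i]]_N -> R[i]) : Prop :=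
  R_differentiable D f /\
  forall s : 'I_(N + N), R_differentiable D (pderiv s f).

(* The Wirtinger derivatives d/dz_i and d/d(conj z_i). *)
Definition dz (R : realType) (N : nat) (i : 'I_N)
    (f : 'cV[R[i]]_N -> R[i]) : 'cV[R[i]]_N -> R[i] :=
  fun p => 2%:R^-1 * (pderiv (lshift N i) f p - 'i%C * pderiv (rshift N i) f p).

Definition dzbar (R : realType) (N : nat) (i : 'I_N)
    (f : 'cV[R[i]]_N -> R[i]) : 'cV[R[i]]_N -> R[i] :=
  fun p => 2%:R^-1 * (pderiv (lshift N i) f p + 'i%C * pderiv (rshift N i) f p).

(* An index in {1, ..., 2p} is an element of 'I_(p + p): lshift p j stands for
   j and rshift p j for p + j.  half_swap exchanges j and p + j. *)
Definition half_swap (p : nat) (k : 'I_(p + p)) : 'I_(p + p) :=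
  match fintype.split k with inl j => rshift p j | inr j => lshift p j end.

(* gamma w = (w_1, ..., w_n, conj w_1, ..., conj w_n). *)
Definition gamma (R : realType) (n : nat) (w : 'cV[R[i]]_n) :
    'cV[R[i]]_(n + n) :=
  col_mx w (map_mx (fun x : R[i] => (x^*)%C) w).

Section System.

(* The coefficients a tau k rho determine the system
   dw = X_1(w) dz + X_2(w) d(conj z). *)
Variables (R : realType) (m n : nat).
Variable a : 'I_n -> 'I_(m + m) -> 'I_(n + n) -> R[i].

Definition X_coef (tau : 'I_n) (k : 'I_(m + m)) (w : 'cV[R[i]]_n) : R[i] :=
  \sum_(xi < n) (a tau k (lshift n xi) * w xi ord0
                 + a tau k (rshift n xi) * ((w xi ord0)^*)%C).

Definition X1 (w : 'cV[R[i]]_n) : 'M[R[i]]_(n, m) :=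
  \matrix_(tau, j) X_coef tau (lshift m j) w.

Definition X2 (w : 'cV[R[i]]_n) : 'M[R[i]]_(n, m) :=
  \matrix_(tau, j) X_coef tau (rshift m j) w.

Definition op_x (k : 'I_(m + m)) (f : 'cV[R[i]]_n -> R[i]) :
    'cV[R[i]]_n -> R[i] :=
  fun w =>
    match fintype.split k with
    | inl j => \sum_(xi < n) (X1 w xi j * dz xi f w
                              + ((X2 w xi j)^*)%C * dzbar xi f w)
    | inr j => \sum_(xi < n) (X2 w xi j * dz xi f w
                              + ((X1 w xi j)^*)%C * dzbar xi f w)
    end.

Definition bracket (k l : 'I_(m + m)) (f : 'cV[R[i]]_n -> R[i]) :
    'cV[R[i]]_n -> R[i] :=
  fun w => op_x k (op_x l f) w - op_x l (op_x k f) w.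

(* The equality [x_k, x_l] = 0 of differential operators is tested on all
   twice continuously R-differentiable functions. *)
Definition completely_solvable : Prop :=
  forall (k l : 'I_(m + m)) (f : 'cV[R[i]]_n -> R[i]),
    R_differentiable2 setT f -> forall w, bracket k l f w = 0.

Definition op_X (k : 'I_(m + m)) (F : 'cV[R[i]]_m -> 'cV[R[i]]_n -> R[i])
    (z : 'cV[R[i]]_m) (w : 'cV[R[i]]_n) : R[i] :=
  match fintype.split k with
  | inl j => dz j (fun z' => F z' w) z
  | inr j => dzbar j (fun z' => F z' w) z
  end + op_x k (F z) w.

(* D is meant to be a domain of C^(m + n), whose points are col_mx z w. *)
Definition first_integral (D : set 'cV[R[i]]_(m + n))
    (F : 'cV[R[i]]_m -> 'cV[R[i]]_n -> R[i]) : Prop :=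
  R_differentiable D (fun p => F (usubmx p) (dsubmx p)) /\
  forall z w, D (col_mx z w) -> forall k : 'I_(m + m), op_X k F z w = 0.

(* The column a_{tau k} and the column (conj a)_{tau k}, in which the two
   halves are exchanged. *)
Definition acol (tau : 'I_n) (k : 'I_(m + m)) : 'cV[R[i]]_(n + n) :=
  \col_rho a tau k rho.

Definition acol_bar (tau : 'I_n) (k : 'I_(m + m)) : 'cV[R[i]]_(n + n) :=
  \col_rho ((a tau k (half_swap rho))^*)%C.

(* The columns of A_j are a_{1 j}, ..., a_{n j}, followed by
   (conj a)_{1, m + j}, ..., (conj a)_{n, m + j}; for A_{m + j} the indices j
   and m + j are exchanged. *)
Definition A_mx (k : 'I_(m + m)) : 'M[R[i]]_(n + n) :=
  row_mx (\matrix_(rho, tau) acol tau k rho ord0)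
         (\matrix_(rho, tau) acol_bar tau (half_swap k) rho ord0).

(* Eigenvectors are column vectors, unlike in mxalgebra.eigenspace. *)
Definition is_common_eigenvector (nu : 'cV[R[i]]_(n + n))
    (lambda : 'I_(m + m) -> R[i]) : Prop :=
  nu != 0 /\ forall k : 'I_(m + m), A_mx k *m nu = lambda k *: nu.

End System.

(* Main.v *)
Require Import Defs.
From HB Require Import structures.
From mathcomp Require Import all_boot all_order all_algebra.
From mathcomp Require Import complex.
From mathcomp Require Import all_classical all_reals all_analysis.
From mathcomp Require Import ring.
Import Order.TTheory GRing.Theory Num.Theory.
Import numFieldNormedType.Exports.
Local Open Scope classical_set_scope.
Local Open Scope ring_scope.
Local Open Scope complex_scope.

(** Write the candidate integral as [L w * cexp (M z)], where [L w] is the sum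
    [nu gamma] and [M z] is the exponent, sign included.  Both are
    combinations of the variables and of their conjugates, and this gives the
    two facts behind the proof.

    Regularity and derivatives.  As a function of the real coordinates, the
    product is [(u + i v) exp (a + i b)] with [u], [v], [a], [b] affine.  Its
    directional derivatives are again of that form
    ([is_derive_Re_exp]), so the existence and the continuity of the partial
    derivatives are settled together.  Read back on [C^N], this is the rule
    [d (L e^M) = (dL + L dM) e^M] for the Wirtinger derivatives
    ([dz_affine_mul_cexp], [dzbar_affine_mul_cexp]); those of
    [sum al_i p_i + be_i p_i^*] are the coefficients [al_i] and [be_i].

    Algebra.  The columns of [A_k] are arranged so that the row
    [gamma(w)^T A_k] lists the coefficients of the operator [x_k] at [w]
    ([X_coef_gamma_A], [conj_X_coef_gamma_A]).  Hence [x_k (nu gamma)] is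
    [gamma^T A_k nu], which is [lambda^k (nu gamma)] for an eigenvector [nu]
    ([op_x_eigenform]).  The derivative of the exponential in [z_j], or in its
    conjugate, contributes [- lambda^k (nu gamma)], and the two terms cancel. *)

Set Implicit Arguments.
Unset Strict Implicit.
Unset Printing Implicit Defensive.

(** * Affine functions and their products with an exponential *)

Section RealAffine.
Variables (R : realType).

(** The increment [u x - u 0] is the linear part of [u], evaluated at [x]. *)
Definition affine (V : lmodType R) (u : V -> R) : Prop :=
  forall t x p, u (t *: x + p) = u p + t * (u x - u 0).

Lemma affineN (V : lmodType R) (u : V -> R) :
  affine u -> affine (fun q => - u q).
Proof. by move=> affu t x p; rewrite affu; ring. Qed.

(** On the line through [p] directed by [x] the function [g \o u] is [g]
    composed with an affine map of one real variable, which reduces the claim to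
    the chain rule on [R]. *)
Lemma is_derive_affine_comp (V : normedModType R) (u : V -> R) (g : R -> R)
    (p x : V) (dg : R) :
  affine u -> is_derive (u p) 1 g dg ->
  is_derive p x (g \o u) (dg * (u x - u 0)).
Proof.
move=> affu dgu.
pose l : R -> R := cst (u p) + (u x - u 0) \*: id.
have lE : (fun h : R => (g \o u) (h *: x + p)) = g \o l.
  by apply/funext => h /=; rewrite affu mulrC.
have dl : is_derive (0 : R) 1 l (u x - u 0).
  by apply: is_derive_eq; rewrite add0r [_ *: _]mulr1.
have dgl : is_derive (0 : R) 1 (g \o l) (dg * (u x - u 0)).
  have l0 : l 0 = u p by rewrite /l /= [LHS]/GRing.add /= scaler0 addr0.
  by apply: is_derive1_comp; rewrite l0.
split.
  by apply/derivable1P; rewrite lE; apply: (@ex_derive _ _ _ _ _ _ _ dgl).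
rewrite -(@derive_val _ _ _ _ _ _ _ dgl) -lE /derive.
set g1 := fun h => h^-1 *: _; set g2 := fun h => h^-1 *: _.
suff -> : g1 = g2 by [].
apply/funext => h; rewrite /g1 /g2 /=.
by rewrite addr0 scale0r add0r [_%:A]mulr1.
Qed.

(** The dimension is finite: [u] is [u 0] plus a combination of coordinates. *)
Lemma affine_continuous N (u : 'cV[R]_N -> R) : affine u -> continuous u.
Proof.
move=> affu.
have uE : u = fun q =>
    u 0 + \sum_(s < N) q s ord0 * (u (delta_mx s ord0) - u 0).
  apply/funext => q.
  rewrite {1}(matrix_sum_delta q).
  under eq_bigr do rewrite big_ord1.
  elim/big_rec2: _ => [|s y1 y2 _ IH]; first by rewrite addr0.
  by rewrite affu IH; ring.
rewrite uE => q; apply: continuousD; first exact: cst_continuous.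
apply: (continuous_big (@add_continuous R)) => s _ {}q.
by apply: (@continuousM R _ (fun q : matrix R N 1 => q s ord0)
  (cst (u (delta_mx s ord0) - u 0)) q);
  [exact: coord_continuous | exact: cst_continuous].
Qed.

(** The real part of [(u + i v) exp (a + i b)].  The imaginary part is the real
    part of [(v - i u) exp (a + i b)], so this one shape serves for both. *)
Definition Re_exp (V : Type) (u v a b : V -> R) (q : V) : R :=
  expR (a q) * (u q * cos (b q) - v q * sin (b q)).

(** This is the real part of [d (f e^g) = (df + f dg) e^g] for
    [f = u + i v] and [g = a + i b]; the derivative keeps the shape [Re_exp]. *)
Lemma is_derive_Re_exp (V : normedModType R) (u v a b : V -> R) (p x : V) :
  affine u -> affine v -> affine a -> affine b ->
  is_derive p x (Re_exp u v a b)
    (Re_exp (fun q => u x - u 0 + (u q * (a x - a 0) - v q * (b x - b 0)))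
            (fun q => v x - v 0 + (u q * (b x - b 0) + v q * (a x - a 0)))
            a b p).
Proof.
move=> affu affv affa affb.
have du := is_derive_affine_comp x affu (is_derive_id (u p) (1 : R)).
have dv := is_derive_affine_comp x affv (is_derive_id (v p) (1 : R)).
have de := is_derive_affine_comp x affa (is_derive_expR (a p)).
have dc := is_derive_affine_comp x affb (is_derive_cos (b p)).
have ds := is_derive_affine_comp x affb (is_derive_sin (b p)).
have -> : Re_exp u v a b =
  (expR \o a) * ((id \o u) * (cos \o b) - (id \o v) * (sin \o b)).
  by apply/funext => q.
apply: is_derive_eq.
rewrite /Re_exp /GRing.scale /=.
(* ring does not see through the pointwise operations on functions. *)
rewrite [((id \o u) * (cos \o b) - (id \o v) * (sin \o b)) p](_ : _ =
  u p * cos (b p) - v p * sin (b p)) //.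
by ring.
Qed.

Lemma continuous_Re_exp (V : topologicalType) (u v a b : V -> R) :
  continuous u -> continuous v -> continuous a -> continuous b ->
  continuous (Re_exp u v a b).
Proof.
move=> cu cv ca cb.
rewrite (_ : Re_exp u v a b =
  (expR \o a) \* (u \* (cos \o b) \- v \* (sin \o b))) // => q.
have cc := continuous_comp (cb q) (@continuous_cos R _).
have cs := continuous_comp (cb q) (@continuous_sin R _).
have ce := continuous_comp (ca q) (@continuous_expR R _).
exact: (continuousM ce
  (continuousB (continuousM (cu q) cc) (continuousM (cv q) cs))).
Qed.

Lemma continuous_derive_Re_exp N (u v a b : 'cV[R]_N -> R) (x : 'cV[R]_N) :
  affine u -> affine v -> affine a -> affine b ->
  continuous (fun q => 'D_x (Re_exp u v a b) q).
Proof.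
move=> affu affv affa affb.
have cu := affine_continuous affu; have cv := affine_continuous affv.
have ca := affine_continuous affa; have cb := affine_continuous affb.
have -> : (fun q => 'D_x (Re_exp u v a b) q) = Re_exp
    (fun q => u x - u 0 + (u q * (a x - a 0) - v q * (b x - b 0)))
    (fun q => v x - v 0 + (u q * (b x - b 0) + v q * (a x - a 0))) a b.
  apply/funext => q.
  have d := is_derive_Re_exp q x affu affv affa affb.
  by rewrite derive_val.
have cM (f : 'cV[R]_N -> R) c q :
    continuous f -> {for q, continuous (f \* cst c)}.
  by move=> cf; apply: continuousM; [exact: cf | exact: cst_continuous].
apply: continuous_Re_exp => // q.
  exact: (continuousD (@cst_continuous _ _ _ q)
    (continuousB (cM _ _ _ cu) (cM _ _ _ cv))).
exact: (continuousD (@cst_continuous _ _ _ q)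
  (continuousD (cM _ _ _ cu) (cM _ _ _ cv))).
Qed.

End RealAffine.

(** * Wirtinger derivatives of real-affine functions times exponentials *)

Section ComplexAffine.
Variable R : realType.
Implicit Types N : nat.

(** Only real scalars [t] are allowed, so that conjugation qualifies. *)
Definition real_affine (V : lmodType R[i]) (L : V -> R[i]) : Prop :=
  forall (t : R) x p, L (t%:C *: x + p) = L p + t%:C * (L x - L 0).

Lemma of_coordsK N (p : 'cV[R[i]]_N) : of_coords (coords p) = p.
Proof.
apply/matrixP => i j; rewrite !mxE (unsplitK (inl i)) (unsplitK (inr i)) !mxE.
by rewrite (ord1 j); case: (p i ord0).
Qed.

Lemma of_coordsZD N t (x p : 'cV[R]_(N + N)) :
  of_coords (t *: x + p) = t%:C *: of_coords x + of_coords p.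
Proof. by apply/matrixP => i j; rewrite !mxE; simpc. Qed.

Lemma of_coords0 N : of_coords (0 : 'cV[R]_(N + N)) = 0.
Proof. by apply/matrixP => i j; rewrite !mxE. Qed.

Lemma of_coords_delta_lshift N (i : 'I_N) :
  of_coords (delta_mx (lshift N i) ord0) = delta_mx i ord0 :> 'cV[R[i]]_N.
Proof.
apply/matrixP => k j; rewrite !mxE (ord1 j) eq_lshift eq_rlshift /=.
by case: (k == i).
Qed.

Lemma of_coords_delta_rshift N (i : 'I_N) :
  of_coords (delta_mx (rshift N i) ord0) =
  'i%C *: delta_mx i ord0 :> 'cV[R[i]]_N.
Proof.
apply/matrixP => k j; rewrite !mxE (ord1 j) eq_rshift eq_lrshift /=.
by case: (k == i); simpc.
Qed.

Lemma affine_re_part N (L : 'cV[R[i]]_N -> R[i]) :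
  real_affine L -> affine (re_part L).
Proof.
move=> affL t x p; rewrite /re_part of_coordsZD affL of_coords0.
by move: (L _) (L _) (L 0) => [a b] [c d] [e f]; simpc.
Qed.

Lemma affine_im_part N (L : 'cV[R[i]]_N -> R[i]) :
  real_affine L -> affine (im_part L).
Proof.
move=> affL t x p; rewrite /im_part of_coordsZD affL of_coords0.
by move: (L _) (L _) (L 0) => [a b] [c d] [e f]; simpc.
Qed.

Lemma re_part_mul_cexp N (L M : 'cV[R[i]]_N -> R[i]) :
  re_part (fun p => L p * cexp (M p)) =
  Re_exp (re_part L) (im_part L) (re_part M) (im_part M).
Proof.
apply/funext => q; rewrite /re_part /im_part /Re_exp /cexp.
by case: (L _) => a b /=; ring.
Qed.

Lemma im_part_mul_cexp N (L M : 'cV[R[i]]_N -> R[i]) :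
  im_part (fun p => L p * cexp (M p)) =
  Re_exp (im_part L) (fun q => - re_part L q) (re_part M) (im_part M).
Proof.
apply/funext => q; rewrite /re_part /im_part /Re_exp /cexp.
by case: (L _) => a b /=; ring.
Qed.

(** The Wirtinger derivative with respect to the variable number [i] of a
    real-affine [L]: a constant, computed from the increments of [L] along
    [e_i] and [i e_i]. *)
Definition wirtinger N (L : 'cV[R[i]]_N -> R[i]) (i : 'I_N) : R[i] :=
  2%:R^-1 * ((L (delta_mx i ord0) - L 0)
             - 'i%C * (L ('i%C *: delta_mx i ord0) - L 0)).

Definition wirtinger_bar N (L : 'cV[R[i]]_N -> R[i]) (i : 'I_N) : R[i] :=
  2%:R^-1 * ((L (delta_mx i ord0) - L 0)
             + 'i%C * (L ('i%C *: delta_mx i ord0) - L 0)).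

Section AffineTimesExp.
Variables (N : nat) (L M : 'cV[R[i]]_N -> R[i]).
Hypotheses (affL : real_affine L) (affM : real_affine M).
Let F p := L p * cexp (M p).

Lemma R_differentiable_affine_mul_cexp D : R_differentiable D F.
Proof.
have affu := affine_re_part affL; have affv := affine_im_part affL.
have affa := affine_re_part affM; have affb := affine_im_part affM.
have affw := affineN affu.
move=> p _ s; rewrite re_part_mul_cexp im_part_mul_cexp; split.
- have d := is_derive_Re_exp (coords p) (delta_mx s ord0) affu affv affa affb.
  exact: ex_derive.
- have d := is_derive_Re_exp (coords p) (delta_mx s ord0) affv affw affa affb.
  exact: ex_derive.
- exact: continuous_derive_Re_exp.
- exact: continuous_derive_Re_exp.
Qed.

Lemma pderiv_affine_mul_cexp s p (e := of_coords (delta_mx s ord0)) :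
  pderiv s F p = (L e - L 0 + L p * (M e - M 0)) * cexp (M p).
Proof.
have affu := affine_re_part affL; have affv := affine_im_part affL.
have affa := affine_re_part affM; have affb := affine_im_part affM.
have affw := affineN affu.
have d1 := is_derive_Re_exp (coords p) (delta_mx s ord0) affu affv affa affb.
have d2 := is_derive_Re_exp (coords p) (delta_mx s ord0) affv affw affa affb.
rewrite /pderiv re_part_mul_cexp im_part_mul_cexp !derive_val.
rewrite /Re_exp /re_part /im_part of_coordsK of_coords0 -/e /cexp.
move: (L e) (L 0) (L p) (M e) (M 0) (M p).
move=> [? ?] [? ?] [? ?] [? ?] [? ?] [? ?].
by apply/eqP; rewrite eq_complex /=; apply/andP; split; apply/eqP; ring.
Qed.

Lemma dz_affine_mul_cexp i p :
  dz i F p = (wirtinger L i + L p * wirtinger M i) * cexp (M p).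
Proof.
rewrite /dz !pderiv_affine_mul_cexp.
by rewrite of_coords_delta_lshift of_coords_delta_rshift /wirtinger; ring.
Qed.

Lemma dzbar_affine_mul_cexp i p :
  dzbar i F p = (wirtinger_bar L i + L p * wirtinger_bar M i) * cexp (M p).
Proof.
rewrite /dzbar !pderiv_affine_mul_cexp.
by rewrite of_coords_delta_lshift of_coords_delta_rshift /wirtinger_bar; ring.
Qed.

End AffineTimesExp.

Definition real_linear_form N (al be : 'I_N -> R[i]) (p : 'cV[R[i]]_N) : R[i] :=
  \sum_(i < N) (al i * p i ord0 + be i * ((p i ord0)^*)%C).

Lemma real_linear_formZD N (al be : 'I_N -> R[i]) (t : R) x p :
  real_linear_form al be (t%:C *: x + p) =
  t%:C * real_linear_form al be x + real_linear_form al be p.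
Proof.
rewrite /real_linear_form mulr_sumr -big_split; apply: eq_bigr => i _ /=.
rewrite !mxE
  (_ : ((t%:C * _ + _)^*)%C = t%:C * ((x i ord0)^*)%C + ((p i ord0)^*)%C).
  by ring.
by rewrite -[t%:C in RHS]conjc_real -rmorphM -rmorphD.
Qed.

Lemma real_linear_form0 N (al be : 'I_N -> R[i]) : real_linear_form al be 0 = 0.
Proof.
by rewrite /real_linear_form big1 // => i _; rewrite mxE conjc0 !mulr0 addr0.
Qed.

Lemma real_affine_real_linear_form N (al be : 'I_N -> R[i]) :
  real_affine (real_linear_form al be).
Proof.
by move=> t x p; rewrite real_linear_formZD real_linear_form0 subr0 addrC.
Qed.

Lemma real_affine_cst (V : lmodType R[i]) c : real_affine (fun _ : V => c).
Proof. by move=> t x p; rewrite subrr mulr0 addr0. Qed.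

Lemma real_affine_comp (V W : lmodType R[i]) (g : {linear V -> W}) L :
  real_affine L -> real_affine (L \o g).
Proof. by move=> affL t x p; rewrite /= linearP affL linear0. Qed.

Lemma real_linear_form_delta N (al be : 'I_N -> R[i]) c i :
  real_linear_form al be (c *: delta_mx i ord0) = al i * c + be i * (c^*)%C.
Proof.
rewrite /real_linear_form (bigD1 i) //= big1 => [|k ki].
  by rewrite !mxE !eqxx mulr1 addr0.
by rewrite !mxE (negbTE ki) mulr0 conjc0 !mulr0 addr0.
Qed.

Lemma wirtinger_cst N c (i : 'I_N) : wirtinger (fun _ : 'cV[R[i]]_N => c) i = 0.
Proof. by rewrite /wirtinger subrr mulr0 subrr mulr0. Qed.

Lemma wirtinger_bar_cst N c (i : 'I_N) :
  wirtinger_bar (fun _ : 'cV[R[i]]_N => c) i = 0.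
Proof. by rewrite /wirtinger_bar subrr mulr0 addr0 mulr0. Qed.

Lemma wirtinger_form N (al be : 'I_N -> R[i]) i :
  wirtinger (real_linear_form al be) i = al i.
Proof.
rewrite /wirtinger real_linear_form0 -[delta_mx i _]scale1r scalerA.
rewrite !real_linear_form_delta mulr1 !subr0 conjc1 !mulr1.
have -> : ('i^*)%C = - 'i%C :> R[i] by simpc.
apply: (mulfI (_ : 2%:R != 0 :> R[i])); first by rewrite pnatr_eq0.
rewrite mulrA divff ?pnatr_eq0 // mul1r.
(* The identity holds modulo the relation i ^+ 2 = -1. *)
by have := sqr_i R; move: ('i%C) => i0 ii; ring: ii.
Qed.

Lemma wirtinger_bar_form N (al be : 'I_N -> R[i]) i :
  wirtinger_bar (real_linear_form al be) i = be i.
Proof.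
rewrite /wirtinger_bar real_linear_form0 -[delta_mx i _]scale1r scalerA.
rewrite !real_linear_form_delta mulr1 !subr0 conjc1 !mulr1.
have -> : ('i^*)%C = - 'i%C :> R[i] by simpc.
apply: (mulfI (_ : 2%:R != 0 :> R[i])); first by rewrite pnatr_eq0.
rewrite mulrA divff ?pnatr_eq0 // mul1r.
by have := sqr_i R; move: ('i%C) => i0 ii; ring: ii.
Qed.

End ComplexAffine.

(** * The operators of the linear system and its matrices *)

Section LinearSystem.
Variables (R : realType) (m n : nat).
Variable a : 'I_n -> 'I_(m + m) -> 'I_(n + n) -> R[i].

Lemma gamma_lshift (w : 'cV[R[i]]_n) xi :
  gamma w (lshift n xi) ord0 = w xi ord0.
Proof. by rewrite /gamma col_mxEu. Qed.

Lemma gamma_rshift (w : 'cV[R[i]]_n) xi :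
  gamma w (rshift n xi) ord0 = ((w xi ord0)^*)%C.
Proof. by rewrite /gamma col_mxEd mxE. Qed.

Lemma half_swap_lshift p (j : 'I_p) : half_swap (lshift p j) = rshift p j.
Proof. by rewrite /half_swap (unsplitK (inl j)). Qed.

Lemma half_swap_rshift p (j : 'I_p) : half_swap (rshift p j) = lshift p j.
Proof. by rewrite /half_swap (unsplitK (inr j)). Qed.

Lemma sum_nu_gamma (nu : 'cV[R[i]]_(n + n)) w :
  \sum_(rho < n + n) nu rho ord0 * gamma w rho ord0 =
  real_linear_form (fun i => nu (lshift n i) ord0)
                   (fun i => nu (rshift n i) ord0) w.
Proof.
rewrite big_split_ord /real_linear_form big_split /=.
congr (_ + _); apply: eq_bigr => i _.
  by rewrite gamma_lshift.
by rewrite gamma_rshift.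
Qed.

Lemma A_mx_lshift k rho xi : A_mx a k rho (lshift n xi) = a xi k rho.
Proof. by rewrite /A_mx row_mxEl !mxE. Qed.

Lemma A_mx_rshift k rho xi :
  A_mx a k rho (rshift n xi) = ((a xi (half_swap k) (half_swap rho))^*)%C.
Proof. by rewrite /A_mx row_mxEr !mxE. Qed.

(** Together with [conj_X_coef_gamma_A]: the row [gamma(w)^T A_k] consists of
    the coefficients of the operator [x_k] at [w], those of the derivations in
    the [w_xi] first, then those of the derivations in their conjugates. *)
Lemma X_coef_gamma_A (w : 'cV[R[i]]_n) k xi :
  X_coef a xi k w = ((gamma w)^T *m A_mx a k) ord0 (lshift n xi).
Proof.
rewrite mxE big_split_ord /= -big_split; apply: eq_bigr => i _.
by rewrite !A_mx_lshift ![_^T _ _]mxE gamma_lshift gamma_rshift /=; ring.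
Qed.

(** Conjugating [X_xi] exchanges the two halves of [gamma w]; this is the
    exchange built into the conjugated columns of [A_k]. *)
Lemma conj_X_coef_gamma_A (w : 'cV[R[i]]_n) k xi :
  ((X_coef a xi (half_swap k) w)^*)%C =
  ((gamma w)^T *m A_mx a k) ord0 (rshift n xi).
Proof.
rewrite mxE big_split_ord /= -big_split /X_coef rmorph_sum.
apply: eq_bigr => i _.
rewrite !A_mx_rshift half_swap_lshift half_swap_rshift ![_^T _ _]mxE.
by rewrite gamma_lshift gamma_rshift rmorphD !rmorphM /= conjcK; ring.
Qed.

(** [half_swap] treats the operators with indices [j] and [m + j] at once. *)
Lemma op_xE k f (w : 'cV[R[i]]_n) :
  op_x a k f w = \sum_(xi < n) (X_coef a xi k w * dz xi f w
    + ((X_coef a xi (half_swap k) w)^*)%C * dzbar xi f w).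
Proof.
case: (split_ordP k) => j ->; rewrite /op_x /half_swap.
  by rewrite (unsplitK (inl j)); apply: eq_bigr => xi _; rewrite !mxE.
by rewrite (unsplitK (inr j)); apply: eq_bigr => xi _; rewrite !mxE.
Qed.

(** The value is [gamma^T A_k nu c]: the operator acts on the gradient [nu c]
    through its row of coefficients [gamma^T A_k], and [A_k] scales [nu].  For
    the first integral, [c] is the exponential, a function of [z] alone. *)
Lemma op_x_eigenform (nu : 'cV[R[i]]_(n + n)) lambda k
    (f : 'cV[R[i]]_n -> R[i]) c w :
  A_mx a k *m nu = lambda *: nu ->
  (forall xi, dz xi f w = nu (lshift n xi) ord0 * c) ->
  (forall xi, dzbar xi f w = nu (rshift n xi) ord0 * c) ->
  op_x a k f w =
  lambda * (\sum_(rho < n + n) nu rho ord0 * gamma w rho ord0) * c.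
Proof.
move=> Anu df dfbar.
have -> : lambda * (\sum_rho nu rho ord0 * gamma w rho ord0) =
          ((gamma w)^T *m A_mx a k *m nu) ord0 ord0.
  rewrite -mulmxA Anu -scalemxAr mxE [in RHS]mxE; congr (_ * _).
  by apply: eq_bigr => rho _; rewrite [_^T _ _]mxE mulrC.
rewrite op_xE [in RHS]mxE big_split_ord /= -big_split mulr_suml.
apply: eq_bigr => xi _.
by rewrite df dfbar X_coef_gamma_A conj_X_coef_gamma_A /= mulrDl !mulrA.
Qed.

End LinearSystem.

Theorem theorem1p3 (R : realType) (m n : nat) (hm : (0 < m)%N) (hn : (0 < n)%N)
  (a : 'I_n -> 'I_(m + m) -> 'I_(n + n) -> R[i])
  (hsolv : completely_solvable a)
  (nu : 'cV[R[i]]_(n + n)) (lambda : 'I_(m + m) -> R[i])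
  (hnu : is_common_eigenvector a nu lambda) :
  first_integral a setT (fun (z : 'cV[R[i]]_m) (w : 'cV[R[i]]_n) =>
    (\sum_(rho < n + n) nu rho ord0 * gamma w rho ord0) *
    cexp (- \sum_(j < m) (lambda (lshift m j) * z j ord0
                          + lambda (rshift m j) * ((z j ord0)^*)%C))).
Proof.
case: hnu => _ Anu.
pose L := real_linear_form (fun i => nu (lshift n i) ord0)
                           (fun i => nu (rshift n i) ord0).
pose M := real_linear_form (fun j => - lambda (lshift m j))
                           (fun j => - lambda (rshift m j)).
pose F (z : 'cV[R[i]]_m) (w : 'cV[R[i]]_n) := L w * cexp (M z).
rewrite [X in first_integral a setT X](_ : _ = F); last first.
  apply/funext => z; apply/funext => w.
  rewrite /F sum_nu_gamma /M /real_linear_form -sumrN.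
  by congr (_ * cexp _); apply: eq_bigr => j _; rewrite opprD !mulNr.
have affL : real_affine L := @real_affine_real_linear_form _ _ _ _.
have affM : real_affine M := @real_affine_real_linear_form _ _ _ _.
split.
  apply: (@R_differentiable_affine_mul_cexp _ _ (L \o dsubmx) (M \o usubmx)).
    exact: real_affine_comp.
  exact: real_affine_comp.
move=> z w _ k.
have op_w : op_x a k (F z) w = lambda k * L w * cexp (M z).
  (* In the variable w the exponent M z is a constant. *)
  have affMz : real_affine (fun _ : 'cV[R[i]]_n => M z).
    exact: real_affine_cst.
  rewrite (op_x_eigenform (Anu k) (c := cexp (M z))) ?sum_nu_gamma // => xi.
    rewrite (dz_affine_mul_cexp affL affMz) wirtinger_form wirtinger_cst.
    by rewrite mulr0 addr0.
  rewrite (dzbar_affine_mul_cexp affL affMz) wirtinger_bar_form.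
  by rewrite wirtinger_bar_cst mulr0 addr0.
(* In the variable z the factor L w is a constant. *)
have affLw : real_affine (fun _ : 'cV[R[i]]_m => L w).
  exact: real_affine_cst.
rewrite /op_X op_w; case: (split_ordP k) => j ->.
  rewrite (dz_affine_mul_cexp affLw affM) wirtinger_form.
  by rewrite wirtinger_cst; ring.
rewrite (dzbar_affine_mul_cexp affLw affM).
by rewrite wirtinger_bar_form wirtinger_bar_cst; ring.
Qed.
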